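(* Let $\langle G,\mathbf{V},\mathcal{M}\rangle$ be an identifiability tuple, i.e. $G$ is a causal graph, $\mathbf{V}$ its set of observed variables, and $\mathcal{M}$ a set of models of $G$. Let $\mathbf{X},\mathbf{Y}$ be sets of treatment and outcome variables with instantiations $\mathbf{x},\mathbf{y}$. The causal effect $\Pr_{\mathbf{x}}(\mathbf{y})$ is identifiable with respect to $\langle G,\mathbf{V},\mathcal{M}\rangle$ if and only if there is an arithmetic circuit for $\Pr_{\mathbf{x}}(\mathbf{y})$ that satisfies the following condition: there is a cut between the root and the leaf nodes such that every node on the cut has a $\langle G,\mathbf{V},\mathcal{M}\rangle$-projection.
   Context: Causal graphs and models. A causal graph $G$ is a DAG over discrete variables, each with a fixed, known finite set of states; a subset $\mathbf{V}$ of the variables is observed and the remaining variables are hidden. A model of $G$ is a full parameterization: parameters $\theta_{w|\mathbf{p}}\in[0,1]$ for every variable $W$ with parents $\mathbf{P}$, every state $w$ and parent instantiation $\mathbf{p}$, with $\sum_w\theta_{w|\mathbf{p}}=1$. A model induces a distribution $\Pr$ over all variables as the product of parameters; $\Pr(\mathbf{V})$ is its marginal on $\mathbf{V}$. The causal effect $\Pr_{\mathbf{x}}(\mathbf{y})$ is the probability of $\mathbf{y}$ under the intervention $do(\mathbf{x})$: the sum, over all full instantiations compatible with $\mathbf{x},\mathbf{y}$, of the product of the parameters of all variables not in $\mathbf{X}$. Identifiability. $\Pr_{\mathbf{x}}(\mathbf{y})$ is identifiable with respect to $\langle G,\mathbf{V},\mathcal{M}\rangle$ if $\Pr^1_{\mathbf{x}}(\mathbf{y})=\Pr^2_{\mathbf{x}}(\mathbf{y})$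 for any two models $M^1,M^2\in\mathcal{M}$ whose induced distributions satisfy $\Pr^1(\mathbf{V})=\Pr^2(\mathbf{V})$. Arithmetic circuits. An arithmetic circuit (AC) is a rooted DAG whose internal nodes are labeled $+$ or $\times$ and whose leaves are constants or parameters $\theta_{w|\mathbf{p}}$. Each node specifies an expression, obtained by bottom-up evaluation; the output is the expression at the root. Under a model, each parameter leaf takes its value from the model. An AC for $\Pr_{\mathbf{x}}(\mathbf{y})$ is one whose output evaluates to $\Pr_{\mathbf{x}}(\mathbf{y})$ under every model in $\mathcal{M}$. A cut between the root and the leaves is a set of nodes (possibly including the root or leaves) that meets every path from the root to a leaf. Expressions and projections. An expression is a composition of constants, parameters $\theta_{w|\mathbf{p}}$, and (conditional or unconditional) probabilities such as $\Pr(a|b)$; it takes a value under each model. Composition is understood broadly: arbitrary functions of these ingredients are allowed (including, e.g., sums over models and indicator functions of the event that $\Pr(\mathbf{V})$ equals a given distribution). Two expressions are $\langle G,\mathbf{V},\mathcal{M}\rangle$-equivalent if they evaluate to the same value under all models in $\mathcal{M}$. If $\mathcal{E}_1$ and $\mathcal{E}_2$ are equivalent and $\mathcal{E}_1$ contains no parameters ($\theta$'s) and mentions no hidden variables (so that $\mathcal{E}_1$ is a function of $\Pr(\mathbf{V})$ alone), then $\mathcal{E}_1$ is called a $\langle G,\mathbf{V},\mathcal{M}\rangle$-projection of $\mathcal{E}_2$. A node has a projection if its expression does. *)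

(* Defs.v *)
From mathcomp Require Import all_boot all_order all_algebra.
From mathcomp Require Import reals.

Set Implicit Arguments.
Unset Strict Implicit.
Unset Printing Implicit Defensive.

Import Order.TTheory GRing.Theory Num.Theory.
Local Open Scope ring_scope.

Definition acyclic (T : finType) (e : rel T) : Prop :=
  forall p : seq T, cycle e p -> p = [::].

Record causal_graph := CausalGraph {
  var : finType;
  state : var -> finType;
  edge : rel var;                       (* [edge u w]: u is a parent of w *)
  edge_acyclic : acyclic edge
}.

Definition parents (G : causal_graph) (w : var G) : {set var G} :=
  [set u | edge u w].

Definition full_inst (G : causal_graph) := {dffun forall w : var G, state w}.

Definition inst (G : causal_graph) (A : {set var G}) :=
  {dffun forall w : {w : var G | w \in A}, state (val w)}.

Definition restrict (G : causal_graph) (A : {set var G}) (z : full_inst G) :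
    inst A :=
  [ffun w : {w : var G | w \in A} => z (val w)].

Definition compatible (G : causal_graph) (A : {set var G})
    (z : full_inst G) (a : inst A) : bool :=
  restrict A z == a.

Record model (R : realType) (G : causal_graph) := Model {
  theta : forall w : var G, state w -> inst (parents w) -> R;
  theta_ge0 : forall w s p, 0 <= @theta w s p;
  theta_le1 : forall w s p, @theta w s p <= 1;
  theta_sum1 : forall w p, \sum_(s : state w) @theta w s p = 1
}.

Definition local_theta (R : realType) (G : causal_graph) (m : model R G)
    (z : full_inst G) (w : var G) : R :=
  theta m (z w) (restrict (parents w) z).

Definition joint (R : realType) (G : causal_graph) (m : model R G)
    (z : full_inst G) : R :=
  \prod_(w : var G) local_theta m z w.

Definition Pr (R : realType) (G : causal_graph) (m : model R G)
    (A : {set var G}) (a : inst A) : R :=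
  \sum_(z : full_inst G | compatible z a) joint m z.

(* The value is 0 when [Pr m b = 0], by the convention x / 0 = 0. *)
Definition cond_Pr (R : realType) (G : causal_graph) (m : model R G)
    (A B : {set var G}) (a : inst A) (b : inst B) : R :=
  (\sum_(z : full_inst G | compatible z a && compatible z b) joint m z)
    / Pr m b.

Definition causal_effect (R : realType) (G : causal_graph) (m : model R G)
    (X Y : {set var G}) (x : inst X) (y : inst Y) : R :=
  \sum_(z : full_inst G | compatible z x && compatible z y)
    \prod_(w : var G | w \notin X) local_theta m z w.

Definition same_observed (R : realType) (G : causal_graph)
    (V : {set var G}) (m1 m2 : model R G) : Prop :=
  forall v : inst V, Pr m1 v = Pr m2 v.

Definition identifiable (R : realType) (G : causal_graph)
    (V : {set var G}) (M : model R G -> Prop)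
    (X Y : {set var G}) (x : inst X) (y : inst Y) : Prop :=
  forall m1 m2 : model R G, M m1 -> M m2 -> same_observed V m1 m2 ->
    causal_effect m1 x y = causal_effect m2 x y.

(* [EApp f args] is the composition of an arbitrary function f, which does not
   itself depend on the model, with a family of expressions indexed by an
   arbitrary (possibly infinite) type. *)
Inductive expr (R : realType) (G : causal_graph) : Type :=
  | EConst (c : R)
  | EParam (w : var G) (s : state w) (p : inst (parents w))
  | EProb (A : {set var G}) (a : inst A)
  | ECondProb (A B : {set var G}) (a : inst A) (b : inst B)
  | EApp (D : Type) (f : (D -> R) -> R) (args : D -> expr R G).

Arguments EConst {R G} c.
Arguments EParam {R G w} s p.
Arguments EProb {R G A} a.
Arguments ECondProb {R G A B} a b.
Arguments EApp {R G D} f args.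

Fixpoint eval (R : realType) (G : causal_graph) (m : model R G)
    (E : expr R G) : R :=
  match E with
  | EConst c => c
  | EParam w s p => theta m s p
  | EProb A a => Pr m a
  | ECondProb A B a b => cond_Pr m a b
  | EApp D f args => f (fun i => eval m (args i))
  end.

Fixpoint parameter_free (R : realType) (G : causal_graph)
    (E : expr R G) : Prop :=
  match E with
  | EParam _ _ _ => False
  | EApp D f args => forall i, parameter_free (args i)
  | _ => True
  end.

Fixpoint mentions_only (R : realType) (G : causal_graph) (V : {set var G})
    (E : expr R G) : Prop :=
  match E with
  | EConst _ => True
  | EParam w _ _ => w \in V /\ parents w \subset V
  | EProb A _ => A \subset V
  | ECondProb A B _ _ => A \subset V /\ B \subset V
  | EApp D f args => forall i, mentions_only V (args i)
  end.

Definition expr_equiv (R : realType) (G : causal_graph)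
    (M : model R G -> Prop) (E1 E2 : expr R G) : Prop :=
  forall m : model R G, M m -> eval m E1 = eval m E2.

Definition is_projection (R : realType) (G : causal_graph)
    (V : {set var G}) (M : model R G -> Prop) (E1 E2 : expr R G) : Prop :=
  [/\ expr_equiv M E1 E2, parameter_free E1 & mentions_only V E1].

Inductive node_label (R : realType) (G : causal_graph) : Type :=
  | LPlus
  | LTimes
  | LConst (c : R)
  | LParam (w : var G) (s : state w) (p : inst (parents w)).

Arguments LPlus {R G}.
Arguments LTimes {R G}.
Arguments LConst {R G} c.
Arguments LParam {R G w} s p.

Definition leaf_label (R : realType) (G : causal_graph)
    (l : node_label R G) : bool :=
  match l with
  | LPlus | LTimes => false
  | LConst _ | LParam _ _ _ => true
  end.

Definition is_leaf (T : finType) (e : rel T) (n : T) : bool :=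
  [forall c, ~~ e n c].

(* Children form a set: using a subcircuit twice below the same node takes an
   intermediate unary node. *)
Record circuit (R : realType) (G : causal_graph) := Circuit {
  node : finType;
  child : rel node;                     (* [child n c]: c is a child of n *)
  root : node;
  label : node -> node_label R G;
  child_acyclic : acyclic child;
  child_rooted : forall n, connect child root n;
  label_leaf : forall n, leaf_label (label n) = is_leaf child n
}.

(* The recursion is bounded by k; no path in a circuit C has more than
   #|node C| nodes, so [node_expr] never reaches the default value (see
   [eval_node_expr]). *)
Fixpoint node_expr_rec (R : realType) (G : causal_graph) (C : circuit R G)
    (k : nat) (n : node C) : expr R G :=
  if k isn't k'.+1 then EConst 0 else
  match label n with
  | LPlus =>
      EApp (fun a : {c : node C | child n c} -> R => \sum_c a c)
           (fun c => node_expr_rec k' (val c))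
  | LTimes =>
      EApp (fun a : {c : node C | child n c} -> R => \prod_c a c)
           (fun c => node_expr_rec k' (val c))
  | LConst c => EConst c
  | LParam w s p => EParam s p
  end.

Definition node_expr (R : realType) (G : causal_graph) (C : circuit R G)
    (n : node C) : expr R G :=
  node_expr_rec #|node C| n.

Definition circuit_output (R : realType) (G : causal_graph)
    (C : circuit R G) : expr R G :=
  node_expr (root C).

Definition circuit_for (R : realType) (G : causal_graph)
    (M : model R G -> Prop) (C : circuit R G)
    (X Y : {set var G}) (x : inst X) (y : inst Y) : Prop :=
  forall m : model R G, M m ->
    eval m (circuit_output C) = causal_effect m x y.

Definition is_cut (R : realType) (G : causal_graph) (C : circuit R G)
    (K : {set node C}) : Prop :=
  forall p : seq (node C),
    path (@child R G C) (root C) p ->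
    is_leaf (@child R G C) (last (root C) p) ->
    has (mem K) (root C :: p).

Definition has_projection (R : realType) (G : causal_graph)
    (V : {set var G}) (M : model R G -> Prop) (C : circuit R G)
    (n : node C) : Prop :=
  exists E : expr R G, is_projection V M E (node_expr n).

Lemma acyclic_connect (T : finType) (e : rel T) (n c : T) :
  acyclic e -> e n c -> ~~ connect e c n.
Proof.
move=> ac enc; apply/negP=> /connectP[p pp nE].
have: cycle e (c :: p) by rewrite /= rcons_path pp -nE.
by move/ac.
Qed.

Lemma card_connect_child (T : finType) (e : rel T) (n c : T) :
  acyclic e -> e n c -> (#|connect e c| < #|connect e n|)%N.
Proof.
move=> ac enc; apply/proper_card/properP; split.
  apply/subsetP=> z; apply: connect_trans; exact: connect1.
by exists n; [exact: connect0 | exact: acyclic_connect enc].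
Qed.

Lemma eval_node_expr_rec (R : realType) (G : causal_graph) (C : circuit R G)
    (m : model R G) (k l : nat) (n : node C) :
  (#|connect (@child R G C) n| <= k)%N ->
  (#|connect (@child R G C) n| <= l)%N ->
  eval m (node_expr_rec k n) = eval m (node_expr_rec l n).
Proof.
elim: k l n => [|k IH] [|l] n //=.
- by rewrite leqn0 => /eqP/card0_eq/(_ n); rewrite [_ \in _]connect0.
- by move=> _; rewrite leqn0 => /eqP/card0_eq/(_ n); rewrite [_ \in _]connect0.
move=> hk hl; case: (label n) => //=; apply: eq_bigr => -[c nc] _ /=.
  by apply: IH; rewrite -ltnS;
    [apply: leq_trans hk | apply: leq_trans hl];
    apply: card_connect_child nc; exact: child_acyclic.
by apply: IH; rewrite -ltnS;
  [apply: leq_trans hk | apply: leq_trans hl];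
  apply: card_connect_child nc; exact: child_acyclic.
Qed.

Lemma eval_node_expr (R : realType) (G : causal_graph) (C : circuit R G)
    (m : model R G) (n : node C) :
  eval m (node_expr n) =
  match label n with
  | LPlus => \sum_(c | child n c) eval m (node_expr c)
  | LTimes => \prod_(c | child n c) eval m (node_expr c)
  | LConst c => c
  | LParam w s p => theta m s p
  end.
Proof.
have E : eval m (node_expr n) = eval m (node_expr_rec #|node C|.+1 n).
  by apply: eval_node_expr_rec; [|apply: leqW]; exact: max_card.
rewrite {}E /=; case: (label n) => //=.
  by rewrite [RHS](reindex_omap (val : {c | child n c} -> node C) insub) /=;
    [apply: eq_big => [[c nc]|//]; rewrite /= insubT nc eqxx
    | move=> c nc; rewrite insubT].
by rewrite [RHS](reindex_omap (val : {c | child n c} -> node C) insub) /=;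
  [apply: eq_big => [[c nc]|//]; rewrite /= insubT nc eqxx
  | move=> c nc; rewrite insubT].
Qed.

(* Main.v *)
Require Import Defs.
From mathcomp Require Import all_boot all_order all_algebra.
From mathcomp Require Import reals.
From mathcomp Require Import boolp.

(** An identifiable effect is a function of the marginal on [V]: send a
    marginal to the effect in any model of [M] inducing it. That function is a
    projection of the root of any circuit for the effect, e.g. of the
    sum-of-products circuit read off its definition, so the root alone is a cut.
    Conversely, a projection takes the same value under two models with equal
    marginals on [V]; this equality propagates from the cut up to the root. *)

Set Implicit Arguments.
Unset Strict Implicit.
Unset Printing Implicit Defensive.

Import Order.TTheory GRing.Theory Num.Theory.
Local Open Scope ring_scope.

(** Along a nonempty cycle the rank would increase strictly and yet return to its first value. *)
Lemma rank_acyclic (T : finType) (e : rel T) (rank : T -> nat) :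
  (forall u v, e u v -> rank u < rank v)%N -> acyclic e.
Proof.
move=> rank_lt [//|u p] /= /(sub_path (e' := relpre rank ltn)) lt_p.
have {lt_p} : path (relpre rank ltn) u (rcons p u) by apply: lt_p => a b /rank_lt.
rewrite -path_map => /(order_path_min ltn_trans) /allP /(_ (rank u)).
by rewrite map_f ?mem_rcons ?mem_head //= ltnn => /(_ isT).
Qed.

Section Observed.

Variables (R : realType) (G : causal_graph) (V : {set var G}).
Implicit Types (m : model R G) (z : full_inst G).

Lemma restrict_sub (A : {set var G}) z z' :
  A \subset V -> restrict V z = restrict V z' -> restrict A z = restrict A z'.
Proof.
move=> /subsetP sAV zz'; apply/ffunP => w; rewrite !ffunE.
have wV := sAV _ (valP w).
by move/ffunP/(_ (exist _ (val w) wV)): zz'; rewrite !ffunE.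
Qed.

(** An event decided by the observed coordinates is a disjoint union of fibres of [restrict V], and
    the mass of each fibre is a value of the marginal on [V]. *)
Lemma eq_observed_event m1 m2 (P : pred (full_inst G)) :
  same_observed V m1 m2 ->
  (forall z z', restrict V z = restrict V z' -> P z = P z') ->
  \sum_(z | P z) joint m1 z = \sum_(z | P z) joint m2 z.
Proof.
move=> eqV PV.
rewrite !(partition_big (restrict V) xpredT) //=; apply: eq_bigr => v _.
(* [P] is constant on the fibre over [v]: either it holds on the whole fibre, or the sum over the
   fibre is empty. *)
have [/existsP[z0 /andP[Pz0 /eqP z0v]]|] :=
  boolP [exists z, P z && (restrict V z == v)].
  have E z : P z && (restrict V z == v) = compatible z v.
    rewrite /compatible; case: eqP => [zv|_]; last by rewrite andbF.
    by rewrite andbT (PV z z0) // zv z0v.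
  by rewrite !(eq_bigl _ _ E); exact: eqV.
by move/existsPn => no; rewrite !big_pred0 // => z; apply/negbTE.
Qed.

Lemma compatible_observed (A : {set var G}) (a : inst A) z z' :
  A \subset V -> restrict V z = restrict V z' ->
  compatible z a = compatible z' a.
Proof. by rewrite /compatible => sAV /(restrict_sub sAV)->. Qed.

Lemma eval_observed m1 m2 (E : expr R G) :
  same_observed V m1 m2 -> parameter_free E -> mentions_only V E ->
  eval m1 E = eval m2 E.
Proof.
move=> eqV.
have eqPr A (a : inst A) : A \subset V -> Pr m1 a = Pr m2 a.
  by move=> sAV; apply: eq_observed_event => // z z'; exact: compatible_observed.
elim: E => [c|w s p|A a|A B a b|D f args IH] //=.
- by move=> _; exact: eqPr.
(* [A] and [B] may overlap, so the numerator is not literally [Pr] of one instantiation; it is still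
   the mass of an observed event. *)
- move=> _ [sA sB]; rewrite /cond_Pr (eqPr B b sB); congr (_ / _).
  by apply: eq_observed_event => // z z' zz'; congr andb; exact: compatible_observed.
- by move=> pf mo; congr f; apply/funext => i; exact: IH.
Qed.

End Observed.

(** Induction on the number of nodes reachable from a node: one that is reached without crossing the
    cut and is not on it must be internal, so its children determine its value. *)
Lemma eval_above_cut (R : realType) (G : causal_graph) (C : circuit R G)
    (K : {set node C}) (m1 m2 : model R G) :
  is_cut K ->
  (forall n, n \in K -> eval m1 (node_expr n) = eval m2 (node_expr n)) ->
  eval m1 (circuit_output C) = eval m2 (circuit_output C).
Proof.
move=> cutK eqK.
(* Generalized to the nodes reached from the root by a path that meets [K] at
   most in its last node. *)
suff main k n (p : seq (node C)) : (#|connect (@child R G C) n| <= k)%N ->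
    path (@child R G C) (Defs.root C) p -> n = last (Defs.root C) p ->
    ~~ has (mem K) (belast (Defs.root C) p) ->
    eval m1 (node_expr n) = eval m2 (node_expr n).
  exact: (main _ (Defs.root C) [::] (leqnn _)).
elim: k n p => [|k IH] n p hk pp nE pK.
  by move: hk; rewrite leqn0 => /eqP/card0_eq/(_ n); rewrite [_ \in _]connect0.
have [/eqK //|nK] := boolP (n \in K).
have pnK : ~~ has (mem K) (Defs.root C :: p).
  by rewrite lastI has_rcons negb_or -nE pK andbT.
(* If [n] were a leaf, [p] would lead from the root to a leaf and miss [K]. *)
have nleaf : ~~ leaf_label (label n).
  rewrite label_leaf nE; apply/negP => /(cutK p pp).
  exact/negP.
have eqc c : child n c -> eval m1 (node_expr c) = eval m2 (node_expr c).
  move=> nc; apply: (IH c (rcons p c)).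
  - by rewrite -ltnS (leq_trans (card_connect_child (@child_acyclic _ _ C) nc)).
  - by rewrite rcons_path pp -nE.
  - by rewrite last_rcons.
  - by rewrite belast_rcons.
by rewrite !eval_node_expr; case: (label n) nleaf => //= _; exact: eq_bigr.
Qed.

Section SumOfProducts.

Variables (R : realType) (G : causal_graph) (I J : finType) (i0 : I) (j0 : J).
Variable L : I -> J -> node_label R G.
Hypothesis leafL : forall i j, leaf_label (L i j).

(* [None] is the sum, [Some (i, None)] the [i]th product and
   [Some (i, Some j)] its [j]th factor. *)
Let sop_node : finType := option (I * option J).

Definition sop_child : rel sop_node := fun n c =>
  match n, c with
  | None, Some (_, None) => true
  | Some (i, None), Some (i', Some _) => i' == i
  | _, _ => false
  end.

Definition sop_label (n : sop_node) : node_label R G :=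
  match n with
  | None => LPlus
  | Some (_, None) => LTimes
  | Some (i, Some j) => L i j
  end.

Lemma sop_acyclic : acyclic sop_child.
Proof.
pose rank (n : sop_node) : nat :=
  match n with None => 0 | Some (_, None) => 1 | Some (_, Some _) => 2 end.
by apply: (@rank_acyclic _ _ rank) => -[[i [j|]]|] [[i' [j'|]]|].
Qed.

Lemma sop_rooted n : connect sop_child None n.
Proof.
case: n => [[i [j|]]|]; last exact: connect0; last exact: connect1.
apply: (@connect_trans _ _ (Some (i, None))); apply: connect1 => //=.
Qed.

(** [i0] and [j0] supply a child to the sum and to every product; a childless node would count as a
    leaf. *)
Lemma sop_label_leaf n : leaf_label (sop_label n) = is_leaf sop_child n.
Proof.
case: n => [[i [j|]]|] /=; rewrite ?leafL; apply/esym.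
- by apply/forallP => -[[i' [j'|]]|].
- by apply/negbTE/forallPn; exists (Some (i, Some j0)); rewrite /= eqxx.
- by apply/negbTE/forallPn; exists (Some (i0, None)).
Qed.

Definition sop_circuit : circuit R G :=
  Circuit sop_acyclic sop_rooted sop_label_leaf.

(** The default value 0 is never reached, by [leafL]. The two reindexings enumerate the children of
    the root and of the [i]th product. *)
Lemma eval_sop_circuit (m : model R G) :
  eval m (circuit_output sop_circuit) =
  \sum_i \prod_j match L i j with
                 | LConst c => c
                 | LParam w s p => theta m s p
                 | _ => 0
                 end.
Proof.
rewrite /circuit_output eval_node_expr /=.
rewrite (reindex_omap (fun i => Some (i, None) : sop_node)
  (fun n : sop_node => if n is Some (i, None) then Some i else None)) /=;
  last by case=> [[i [j|]]|].
apply: eq_big => [i|i _]; first by rewrite eqxx.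
rewrite eval_node_expr /=.
rewrite (reindex_omap (fun j => Some (i, Some j) : sop_node)
  (fun n : sop_node => if n is Some (_, Some j) then Some j else None)) /=;
  last by case=> [[i' [j|]]|] // /eqP->.
apply: eq_big => [j|j _]; first by rewrite !eqxx.
by rewrite eval_node_expr /=; case: (L i j) (leafL i j).
Qed.

End SumOfProducts.

(* The indices [None] add a null term and a constant factor, so that neither
   the sum nor any product is empty. *)
Definition effect_label (R : realType) (G : causal_graph) (X Y : {set var G})
    (x : inst X) (y : inst Y) (oz : option (full_inst G))
    (ow : option (var G)) : node_label R G :=
  match oz, ow with
  | None, _ => LConst 0
  | Some z, None => LConst (compatible z x && compatible z y)%:R
  | Some z, Some w =>
      if w \in X then LConst 1 else LParam (z w) (restrict (parents w) z)
  end.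

(** The side conditions of the defining sum become factors: an incompatible instantiation carries a
    factor 0, and a variable of [X] a factor 1. *)
Lemma effect_circuit (R : realType) (G : causal_graph)
    (M : model R G -> Prop) (X Y : {set var G}) (x : inst X) (y : inst Y) :
  exists C : circuit R G, circuit_for M C x y.
Proof.
have leafL oz ow : leaf_label (effect_label R x y oz ow).
  by case: oz ow => [z|] [w|] //=; case: ifP.
exists (sop_circuit None None leafL) => m _.
have big_option (T : finType) idx (op : Monoid.com_law idx)
    (F : option T -> R) :
    \big[op/idx]_i F i = op (F None) (\big[op/idx]_i F (Some i)).
  rewrite (bigD1 None) //=; congr (op _ _).
  by rewrite (reindex_omap Some id) /=; [apply: eq_bigl => i; rewrite eqxx | case].
(* The extra term is a product with a factor 0 at [None], so it vanishes even when [G] has no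
   variables. *)
rewrite eval_sop_circuit big_option /= big_option /= mul0r add0r.
rewrite /causal_effect [RHS]big_mkcond; apply: eq_bigr => z _.
rewrite big_option /=; case: ifP => _; rewrite ?mul0r // mul1r.
by rewrite [RHS]big_mkcond; apply: eq_bigr => w _; case: (w \in X).
Qed.

Lemma identifiable_projection (R : realType) (G : causal_graph)
    (V : {set var G}) (M : model R G -> Prop) (X Y : {set var G})
    (x : inst X) (y : inst Y) :
  identifiable V M x y ->
  exists E : expr R G, [/\ forall m, M m -> eval m E = causal_effect m x y,
    parameter_free E & mentions_only V E].
Proof.
move=> idM.
(* The model is picked by choice, and identifiability makes the effect independent of the pick. The
   value 0 is for those [d] that no model of [M] induces. *)
pose f (d : inst V -> R) : R :=
  if pselect (exists m, M m /\ forall v : inst V, Pr m v = d v) is left ex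
  then causal_effect (projT1 (cid ex)) x y else 0.
exists (EApp f (fun v : inst V => EProb v)); split=> //= m Mm.
rewrite /f; case: pselect => [ex|[]]; last by exists m.
by case: (cid ex) => m' /= [Mm' eqV]; exact: idM.
Qed.

Theorem proposition4 (R : realType) (G : causal_graph) (V : {set var G})
    (M : model R G -> Prop) (X Y : {set var G}) (x : inst X) (y : inst Y) :
  identifiable V M x y <->
  exists C : circuit R G,
    circuit_for M C x y /\
    exists K : {set node C},
      is_cut K /\ (forall n : node C, n \in K -> has_projection V M n).
Proof.
split=> [/identifiable_projection[E [evE pfE moE]]|].
  have [C Cxy] := effect_circuit M x y.
  exists C; split=> //; exists [set Defs.root C]; split=> [p _ _|n /set1P->].
    by rewrite /= inE eqxx.
  by exists E; split=> // m Mm; rewrite evE // -Cxy.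
move=> [C [Cxy [K [cutK projK]]]] m1 m2 M1 M2 eqV.
(* Both effects become outputs of [C], so it suffices to compare the two models on the cut, where
   each node is replaced by its projection. *)
rewrite -!Cxy //; apply: (eval_above_cut cutK) => n /projK[E [eqE pfE moE]].
by rewrite -!eqE //; exact: eval_observed eqV pfE moE.
Qed.
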